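(* Let $\alpha\in(0,1)$, $\sigma=1-\frac{\alpha}{2}$, and let $c^{(\alpha,\sigma)}_{i,k}$ be the L2-1$_\sigma$ coefficients defined in the context. Let $k\ge0$. Then for sufficiently small temporal stepsize $\tau$: (1) for any one-dimensional grid functions $v^0,\dots,v^{k+1}\in\mathcal{U}_h$, $$\sum_{i=1}^{k+1}c^{(\alpha,\sigma)}_{i,k}\big(v^i-v^{i-1},\sigma v^{k+1}+(1-\sigma)v^k\big)_h\ge\frac12\sum_{i=1}^{k+1}c^{(\alpha,\sigma)}_{i,k}\big(\|v^i\|_h^2-\|v^{i-1}\|_h^2\big);$$ (2) for any two-dimensional grid functions $w^0,\dots,w^{k+1}\in\mathcal{S}^\circ_h$, $$\sum_{i=1}^{k+1}c^{(\alpha,\sigma)}_{i,k}\big(w^i-w^{i-1},\sigma w^{k+1}+(1-\sigma)w^k\big)_{h^2}\ge\frac12\sum_{i=1}^{k+1}c^{(\alpha,\sigma)}_{i,k}\big(\|w^i\|_{L^2_h}^2-\|w^{i-1}\|_{L^2_h}^2\big).$$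
   Context: Time grid: $\tilde a>0$, $T>\tilde a$, $N\in\mathbb{Z}^+$, $\tau=(T-\tilde a)/N$, $t_k=\tilde a+k\tau$, $t_{k+\sigma}=t_k+\sigma\tau$. For $1\le i\le k$: $a^{(\alpha,\sigma)}_{i,k}=(\log\frac{t_{k+\sigma}}{t_{i-1}})^{1-\alpha}-(\log\frac{t_{k+\sigma}}{t_{i}})^{1-\alpha}$, $b^{(\alpha,\sigma)}_{i,k}=\frac{1}{\log\frac{t_{i+1}}{t_{i-1}}}\{\frac{2}{2-\alpha}[(\log\frac{t_{k+\sigma}}{t_{i-1}})^{2-\alpha}-(\log\frac{t_{k+\sigma}}{t_{i}})^{2-\alpha}]-\log\frac{t_i}{t_{i-1}}[(\log\frac{t_{k+\sigma}}{t_{i}})^{1-\alpha}+(\log\frac{t_{k+\sigma}}{t_{i-1}})^{1-\alpha}]\}$. Coefficients: $c^{(\alpha,\sigma)}_{1,0}=\frac{(\log\frac{t_\sigma}{t_0})^{1-\alpha}}{\Gamma(2-\alpha)\log\frac{t_1}{t_0}}$; for $k\ge1$: $c^{(\alpha,\sigma)}_{1,k}=\frac{a^{(\alpha,\sigma)}_{1,k}-b^{(\alpha,\sigma)}_{1,k}}{\Gamma(2-\alpha)\log\frac{t_1}{t_0}}$, $c^{(\alpha,\sigma)}_{i,k}=\frac{a^{(\alpha,\sigma)}_{i,k}+b^{(\alpha,\sigma)}_{i-1,k}-b^{(\alpha,\sigma)}_{i,k}}{\Gamma(2-\alpha)\log\frac{t_i}{t_{i-1}}}$ for $2\le i\le k$,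 $c^{(\alpha,\sigma)}_{k+1,k}=\frac{b^{(\alpha,\sigma)}_{k,k}+(\log\frac{t_{k+\sigma}}{t_k})^{1-\alpha}}{\Gamma(2-\alpha)\log\frac{t_{k+1}}{t_k}}$. One-dimensional grid: $\mathcal{U}_h=\{w=(w_0,\dots,w_M)\}$ on $x_j=a+jh$, $h=(b-a)/M$; $(w,v)_h=h\sum_{j=1}^{M-1}w_jv_j$, $\|w\|_h^2=(w,w)_h$. Two-dimensional grid: $x_j=-L+jh$, $y_k=-L+kh$, $h=2L/M$; $\mathcal{S}^\circ_h$ is the set of grid functions $\{w_{jk}\}_{0\le j,k\le M}$ with $w_{jk}=0$ on the boundary points; $(w,v)_{h^2}=h^2\sum_{j=1}^{M-1}\sum_{k=1}^{M-1}w_{jk}v_{jk}$, $\|w\|^2_{L^2_h}=(w,w)_{h^2}$. *)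

(* Defs.v *)
From Stdlib Require Import Reals.
From Coquelicot Require Import Coquelicot.
Open Scope R_scope.

(* Euler Gamma function, for s > 1: Gamma s = lim_{n->oo} int_0^n x^(s-1) e^(-x) dx.
   (Rpower 0 _ = 1 in Stdlib, which only changes the integrand ta the single
   point x = 0 and hence does not affect the Riemann integral.) *)
Definition Gamma (s : R) : R :=
  real (Lim_seq (fun n : nat => RInt (fun x => Rpower x (s - 1) * exp (- x)) 0 (INR n))).

(* time grid (ta = tilde a): t_x = ta + x * tau, for real x (so that t_{k+sigma} makes sense) *)
Definition tgrid (ta tau x : R) : R := ta + x * tau.

Definition a_coef (alpha sigma ta tau : R) (i k : nat) : R :=
  let tks := tgrid ta tau (INR k + sigma) in
  Rpower (ln (tks / tgrid ta tau (INR (pred i)))) (1 - alpha)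
  - Rpower (ln (tks / tgrid ta tau (INR i))) (1 - alpha).

Definition b_coef (alpha sigma ta tau : R) (i k : nat) : R :=
  let tks := tgrid ta tau (INR k + sigma) in
  let tim1 := tgrid ta tau (INR (pred i)) in
  let ti := tgrid ta tau (INR i) in
  let tip1 := tgrid ta tau (INR (S i)) in
  / ln (tip1 / tim1) *
  (2 / (2 - alpha) *
     (Rpower (ln (tks / tim1)) (2 - alpha) - Rpower (ln (tks / ti)) (2 - alpha))
   - ln (ti / tim1) *
     (Rpower (ln (tks / ti)) (1 - alpha) + Rpower (ln (tks / tim1)) (1 - alpha))).

(* c^{(alpha,sigma)}_{i,k}, 1 <= i <= k+1 (value 0 outside this range, never used) *)
Definition c_coef (alpha sigma ta tau : R) (i k : nat) : R :=
  let G := Gamma (2 - alpha) in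
  let t := tgrid ta tau in
  match k with
  | O =>
      if Nat.eqb i 1 then
        Rpower (ln (t sigma / t 0)) (1 - alpha) / (G * ln (t 1 / t 0))
      else 0
  | S _ =>
      if Nat.eqb i 1 then
        (a_coef alpha sigma ta tau 1 k - b_coef alpha sigma ta tau 1 k)
          / (G * ln (t 1 / t 0))
      else if andb (2 <=? i)%nat (i <=? k)%nat then
        (a_coef alpha sigma ta tau i k + b_coef alpha sigma ta tau (pred i) k
           - b_coef alpha sigma ta tau i k)
          / (G * ln (t (INR i) / t (INR (pred i))))
      else if Nat.eqb i (S k) then
        (b_coef alpha sigma ta tau k k
           + Rpower (ln (t (INR k + sigma) / t (INR k))) (1 - alpha))
          / (G * ln (t (INR (S k)) / t (INR k)))
      else 0
  end.

(* 1D grid functions on x_0..x_M are represented as u : nat -> R (only indices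
   0..M matter); discrete inner product (u,v)_h = h * sum_{j=1}^{M-1} u_j v_j *)
Definition ip1 (h : R) (M : nat) (u v : nat -> R) : R :=
  h * sum_n_m (fun j => u j * v j) 1 (M - 1).

(* 2D grid functions w_{jl}, 0 <= j,l <= M, as w : nat -> nat -> R;
   (u,v)_{h^2} = h^2 * sum_{j=1}^{M-1} sum_{l=1}^{M-1} u_{jl} v_{jl} *)
Definition ip2 (h : R) (M : nat) (u v : nat -> nat -> R) : R :=
  h ^ 2 * sum_n_m (fun j => sum_n_m (fun l => u j l * v j l) 1 (M - 1)) 1 (M - 1).

(* membership in S°_h: vanishes ta the boundary grid points *)
Definition zero_boundary (M : nat) (w : nat -> nat -> R) : Prop :=
  forall j l : nat, (j <= M)%nat -> (l <= M)%nat ->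
    (j = 0 \/ j = M \/ l = 0 \/ l = M)%nat -> w j l = 0.

(* Main.v *)
Require Import Defs.
From Stdlib Require Import Reals Psatz Arith Bool FunctionalExtensionality.
From Coquelicot Require Import Coquelicot.
Open Scope R_scope.

(* With [x = y_(k+1) - y_k] and [V_i = s x (y_k - y_(i-1)) + (y_k - y_(i-1))^2 / 2], the i-th term
   of the difference of the two sides is [c_i (V_i - V_(i+1))] for [i <= k] and
   [c_(k+1) (s - 1/2) x^2] for [i = k + 1]. As [V_i >= - s^2 x^2 / 2] and [V_(k+1) = 0], summation
   by parts makes the difference nonnegative for every grid value as soon as [c_1 >= 0], [c_i] is
   nondecreasing up to [k] and [s^2 c_k <= (2 s - 1) c_(k+1)]; the discrete inner products are
   positive linear functionals, so this scalar inequality lifts to them.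
   With [d_j = ln (t_(k+sigma) / t_j)], the L2-1_sigma coefficients are a positive multiple of a
   continuous function of [d_j / (tau / ta)], which tends to the uniform grid [k + sigma - j] as
   [tau -> 0]. There the three conditions hold strictly by the concavity of [y ^ (1 - alpha)]: its
   trapezoidal-rule errors are positive, decreasing and smaller than its increments. Hence they
   hold for all small [tau]. *)

Lemma sum_n_m_Rscal (a : R) (f : nat -> R) n m :
  sum_n_m (fun i => a * f i) n m = a * sum_n_m f n m.
Proof. exact (sum_n_m_mult_l a f n m). Qed.

Lemma sum_n_m_Rminus (f g : nat -> R) n m :
  sum_n_m (fun i => f i - g i) n m = sum_n_m f n m - sum_n_m g n m.
Proof.
  replace (sum_n_m f n m - sum_n_m g n m) with (sum_n_m f n m + -1 * sum_n_m g n m) by ring.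
  rewrite <- sum_n_m_Rscal.
  transitivity (sum_n_m (fun i => plus (f i) (-1 * g i)) n m).
  - apply sum_n_m_ext; intros i. change (f i - g i = f i + -1 * g i). ring.
  - exact (sum_n_m_plus f (fun i => -1 * g i) n m).
Qed.

Lemma sum_n_m_Rnonneg (f : nat -> R) n m : (forall i, 0 <= f i) -> 0 <= sum_n_m f n m.
Proof.
  intros Hf. rewrite <- (sum_n_m_const_zero n m : sum_n_m (fun _ => 0) n m = 0).
  now apply sum_n_m_le.
Qed.

Lemma sum_n_m_Rsucc (f : nat -> R) n m :
  (n <= S m)%nat -> sum_n_m f n (S m) = sum_n_m f n m + f (S m).
Proof. exact (sum_n_Sm f n m). Qed.

Lemma sum_n_m_Rext_loc (f g : nat -> R) n m :
  (forall i, (n <= i <= m)%nat -> f i = g i) -> sum_n_m f n m = sum_n_m g n m.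
Proof. exact (sum_n_m_ext_loc f g n m). Qed.

(** * The energy inequality for admissible weights *)

Definition admissible (s : R) (k : nat) (c : nat -> R) : Prop :=
  0 <= c 1%nat /\ (forall i, (2 <= i <= k)%nat -> c (pred i) <= c i) /\
  ((1 <= k)%nat -> s * s * c k <= (2 * s - 1) * c (S k)).

Lemma sum_by_parts_lower_bound (c V : nat -> R) (L : R) n : (1 <= n)%nat ->
  0 <= c 1%nat -> (forall i, (2 <= i <= n)%nat -> c (pred i) <= c i) ->
  (forall i, - L <= V i) ->
  - L * c n <= sum_n_m (fun i => c i * (V i - V (S i))) 1 n + c n * V (S n).
Proof.
  intros Hn Hc1 Hmon HV. induction n as [|n IH]; [lia|].
  destruct n as [|n].
  - rewrite sum_n_n. specialize (HV 1%nat). nra.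
  - rewrite sum_n_m_Rsucc by lia.
    specialize (IH ltac:(lia) ltac:(intros; apply Hmon; lia)).
    specialize (Hmon (S (S n)) ltac:(lia)). specialize (HV (S (S n))).
    cbn [pred] in Hmon. nra.
Qed.

Lemma energy_ineq_scalar (s : R) (k : nat) (c y : nat -> R) :
  1/2 <= s -> admissible s k c ->
  0 <= sum_n_m (fun i => c i * ((y i - y (pred i)) * (s * y (S k) + (1 - s) * y k)
                                - 1/2 * (y i * y i - y (pred i) * y (pred i)))) 1 (S k).
Proof.
  intros Hs [Hc1 [Hmon Hlast]].
  set (x := y (S k) - y k).
  assert (Hlast_term : x * (s * y (S k) + (1 - s) * y k)
            - 1/2 * (y (S k) * y (S k) - y k * y k) = (s - 1/2) * (x * x)).
  { unfold x. field. }
  rewrite sum_n_m_Rsucc by lia. cbn [pred]. fold x. rewrite Hlast_term.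
  destruct k as [|k].
  - rewrite sum_n_m_zero by lia. cbn. rewrite Rplus_0_l.
    apply Rmult_le_pos; [exact Hc1 | apply Rmult_le_pos; [lra | apply Rle_0_sqr]].
  - set (V i := s * x * (y (S k) - y (pred i)) + (y (S k) - y (pred i)) ^ 2 / 2).
    rewrite (sum_n_m_Rext_loc _ (fun i => c i * (V i - V (S i)))).
    2:{ intros [|i] Hi; [lia|]. unfold V, x. cbn [pred]. field. }
    assert (HV : forall i, - (s * s * x * x / 2) <= V i).
    { intros i. unfold V. pose proof (pow2_ge_0 (y (S k) - y (pred i) + s * x)). nra. }
    assert (Hsum := sum_by_parts_lower_bound c V _ (S k) ltac:(lia) Hc1 Hmon HV).
    assert (HV0 : V (S (S k)) = 0) by (unfold V; cbn [pred]; field).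
    rewrite HV0, Rmult_0_r, Rplus_0_r in Hsum.
    specialize (Hlast ltac:(lia)). nra.
Qed.

Section PositiveFunctional.

Variables (X : Type) (Lam : (X -> R) -> R).
Hypothesis Lam_plus : forall f g, Lam (fun x => f x + g x) = Lam f + Lam g.
Hypothesis Lam_scal : forall a f, Lam (fun x => a * f x) = a * Lam f.
Hypothesis Lam_nonneg : forall f, (forall x, 0 <= f x) -> 0 <= Lam f.
Hypothesis Lam_ext : forall f g, (forall x, f x = g x) -> Lam f = Lam g.

Lemma Lam_zero : Lam (fun _ => 0) = 0.
Proof.
  rewrite (Lam_ext _ (fun x => 0 * 0)) by (intros; ring).
  rewrite Lam_scal. ring.
Qed.

Lemma Lam_sum (F : nat -> X -> R) n m :
  Lam (fun x => sum_n_m (fun i => F i x) n m) = sum_n_m (fun i => Lam (F i)) n m.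
Proof.
  induction m as [|m IH].
  - destruct n as [|n].
    + rewrite sum_n_n. apply Lam_ext; intros x. exact (sum_n_n (fun i => F i x) 0).
    + rewrite sum_n_m_zero by lia. etransitivity; [|exact Lam_zero].
      apply Lam_ext; intros x. apply (sum_n_m_zero (fun i => F i x)); lia.
  - destruct (le_lt_dec n (S m)) as [Hnm|Hnm].
    + rewrite sum_n_m_Rsucc, <- IH, <- Lam_plus by lia.
      apply Lam_ext; intros x. apply (sum_n_m_Rsucc (fun i => F i x)); lia.
    + rewrite sum_n_m_zero by lia. etransitivity; [|exact Lam_zero].
      apply Lam_ext; intros x. apply (sum_n_m_zero (fun i => F i x)); lia.
Qed.

Lemma Lam_minus f g : Lam (fun x => f x - g x) = Lam f - Lam g.
Proof.
  rewrite (Lam_ext _ (fun x => f x + -1 * g x)) by (intros; ring).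
  rewrite Lam_plus, Lam_scal. ring.
Qed.

Lemma energy_ineq_functional (s : R) (k : nat) (c : nat -> R) (y : nat -> X -> R) :
  1/2 <= s -> admissible s k c ->
  sum_n_m (fun i => c i * Lam (fun x => (y i x - y (pred i) x)
                                      * (s * y (S k) x + (1 - s) * y k x))) 1 (S k)
  >= 1/2 * sum_n_m (fun i => c i * (Lam (fun x => y i x * y i x)
                                  - Lam (fun x => y (pred i) x * y (pred i) x))) 1 (S k).
Proof.
  intros Hs Hc. apply Rle_ge, Rminus_le_0.
  rewrite <- sum_n_m_Rscal, <- sum_n_m_Rminus.
  rewrite (sum_n_m_Rext_loc _ (fun i => Lam (fun x => c i * ((y i x - y (pred i) x)
      * (s * y (S k) x + (1 - s) * y k x) - 1/2 * (y i x * y i x - y (pred i) x * y (pred i) x))))).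
  2:{ intros i _. rewrite Lam_scal, Lam_minus, Lam_scal, Lam_minus. ring. }
  rewrite <- Lam_sum. apply Lam_nonneg. intros x.
  exact (energy_ineq_scalar s k c (fun i => y i x) Hs Hc).
Qed.

End PositiveFunctional.

Lemma ip1_energy_ineq (s h : R) (k M : nat) (c : nat -> R) (v : nat -> nat -> R) :
  0 <= h -> 1/2 <= s -> admissible s k c ->
  sum_n_m (fun i => c i * ip1 h M (fun j => v i j - v (pred i) j)
             (fun j => s * v (S k) j + (1 - s) * v k j)) 1 (S k)
  >= 1 / 2 * sum_n_m (fun i => c i * (ip1 h M (v i) (v i)
                                    - ip1 h M (v (pred i)) (v (pred i)))) 1 (S k).
Proof.
  intros Hh. apply (energy_ineq_functional nat (fun f => h * sum_n_m f 1 (M - 1))).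
  - intros f g. rewrite <- Rmult_plus_distr_l. f_equal. exact (sum_n_m_plus f g 1 (M - 1)).
  - intros a f. rewrite sum_n_m_Rscal. ring.
  - intros f Hf. apply Rmult_le_pos; [exact Hh | now apply sum_n_m_Rnonneg].
  - intros f g Hfg. f_equal. now apply sum_n_m_ext.
Qed.

Lemma ip2_energy_ineq (s h : R) (k M : nat) (c : nat -> R) (w : nat -> nat -> nat -> R) :
  1/2 <= s -> admissible s k c ->
  sum_n_m (fun i => c i * ip2 h M (fun j l => w i j l - w (pred i) j l)
             (fun j l => s * w (S k) j l + (1 - s) * w k j l)) 1 (S k)
  >= 1 / 2 * sum_n_m (fun i => c i * (ip2 h M (w i) (w i)
                                    - ip2 h M (w (pred i)) (w (pred i)))) 1 (S k).
Proof.
  set (sum2 := fun f : nat * nat -> R =>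
                 sum_n_m (fun j => sum_n_m (fun l => f (j, l)) 1 (M - 1)) 1 (M - 1)).
  apply (energy_ineq_functional (nat * nat) (fun f => h ^ 2 * sum2 f))
    with (y := fun i p => w i (fst p) (snd p)).
  - intros f g. rewrite <- Rmult_plus_distr_l. f_equal. unfold sum2.
    etransitivity;
      [|exact (sum_n_m_plus (fun j => sum_n_m (fun l => f (j, l)) 1 (M - 1))
                            (fun j => sum_n_m (fun l => g (j, l)) 1 (M - 1)) 1 (M - 1))].
    apply sum_n_m_ext; intros j.
    exact (sum_n_m_plus (fun l => f (j, l)) (fun l => g (j, l)) 1 (M - 1)).
  - intros a f. enough (sum2 (fun x => a * f x) = a * sum2 f) as -> by ring.
    unfold sum2. rewrite <- sum_n_m_Rscal. apply sum_n_m_ext; intros j.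
    exact (sum_n_m_Rscal a (fun l => f (j, l)) 1 (M - 1)).
  - intros f Hf. apply Rmult_le_pos; [apply pow2_ge_0|].
    apply sum_n_m_Rnonneg; intros j. now apply sum_n_m_Rnonneg.
  - intros f g Hfg. unfold sum2. f_equal. apply sum_n_m_ext; intros j. now apply sum_n_m_ext.
Qed.

Lemma Rpower_gt_0 x a : 0 < Rpower x a.
Proof. apply exp_pos. Qed.

Lemma Rpower_opp_decreasing e u v : 0 < e -> 0 < u < v -> Rpower v (- e) < Rpower u (- e).
Proof.
  intros He Huv. rewrite !Rpower_Ropp. apply Rinv_lt_contravar.
  - apply Rmult_lt_0_compat; apply Rpower_gt_0.
  - apply Rlt_Rpower_l; lra.
Qed.

Lemma is_derive_Rpower e x : 0 < x -> is_derive (fun y => Rpower y e) x (e * Rpower x (e - 1)).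
Proof. intros Hx. apply is_derive_Reals, derivable_pt_lim_power, Hx. Qed.

Lemma Derive_Rpower e x : 0 < x -> Derive (fun y => Rpower y e) x = e * Rpower x (e - 1).
Proof. intros Hx. apply is_derive_unique, is_derive_Rpower, Hx. Qed.

Lemma lt_of_derive_pos (H h : R -> R) a b : a < b ->
  (forall t, a <= t <= b -> is_derive H t (h t)) -> (forall t, a < t < b -> 0 < h t) ->
  H a < H b.
Proof.
  intros Hab Hd Hp. destruct (MVT_cor2 H h a b Hab) as [c [Hc1 Hc2]].
  - intros c Hc. apply is_derive_Reals. auto.
  - specialize (Hp c Hc2). nra.
Qed.

Lemma le_of_derive_nonneg (H h : R -> R) a b : a < b ->
  (forall t, a <= t <= b -> is_derive H t (h t)) -> (forall t, a < t < b -> 0 <= h t) ->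
  H a <= H b.
Proof.
  intros Hab Hd Hp. destruct (MVT_cor2 H h a b Hab) as [c [Hc1 Hc2]].
  - intros c Hc. apply is_derive_Reals. auto.
  - specialize (Hp c Hc2). nra.
Qed.

Lemma Rpower_1_plus x e : 0 < x -> Rpower x (1 + e) = x * Rpower x e.
Proof. intros Hx. rewrite Rpower_plus, Rpower_1 by exact Hx. reflexivity. Qed.

Lemma is_lim_mult_fin (f g : R -> R) (x : Rbar) (a b : R) :
  is_lim f x a -> is_lim g x b -> is_lim (fun y => f y * g y) x (a * b).
Proof. intros Hf Hg. exact (is_lim_mult f g x a b Hf Hg I). Qed.

Lemma is_lim_inv_fin (f : R -> R) (x : Rbar) (a : R) :
  is_lim f x a -> a <> 0 -> is_lim (fun y => / f y) x (/ a).
Proof. intros Hf Ha. apply (is_lim_inv f x a Hf). now injection. Qed.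

Lemma is_lim_div_fin (f g : R -> R) (x : Rbar) (a b : R) :
  is_lim f x a -> is_lim g x b -> b <> 0 -> is_lim (fun y => f y / g y) x (a / b).
Proof. intros. apply is_lim_mult_fin; [|apply is_lim_inv_fin]; auto. Qed.

Lemma is_lim_Rpower (f : R -> R) (x : Rbar) (a e : R) :
  is_lim f x a -> 0 < a -> is_lim (fun y => Rpower (f y) e) x (Rpower a e).
Proof.
  intros Hf Ha. apply (is_lim_comp_continuous f (fun y => Rpower y e)); [exact Hf|].
  apply continuity_pt_filterlim, derivable_continuous_pt.
  exists (e * Rpower a (e - 1)). now apply derivable_pt_lim_power.
Qed.

Ltac solve_is_lim Hd :=
  repeat match goal with
  | |- is_lim (fun _ => ?c) _ _ => apply is_lim_const
  | |- is_lim (fun _ => _ - _) _ _ => apply is_lim_minus'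
  | |- is_lim (fun _ => _ + _) _ _ => apply is_lim_plus'
  | |- is_lim (fun _ => _ / _) _ _ => apply is_lim_div_fin
  | |- is_lim (fun _ => _ * _) _ _ => apply is_lim_mult_fin
  | |- is_lim (fun _ => / _) _ _ => apply is_lim_inv_fin
  | |- is_lim (fun _ => Rpower _ _) _ _ => apply is_lim_Rpower
  | |- is_lim (fun _ => _ _ _) _ _ => apply Hd
  end.

Lemma filter_forall_le {T : Type} {F : (T -> Prop) -> Prop} {FF : Filter F}
  (P : nat -> T -> Prop) m :
  (forall i, (i <= m)%nat -> F (P i)) -> F (fun x => forall i, (i <= m)%nat -> P i x).
Proof.
  induction m as [|m IH]; intros H.
  - apply (filter_imp (P 0%nat)); [|apply H; lia].
    intros x Hx i Hi. now replace i with 0%nat by lia.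
  - apply (filter_imp (fun x => (forall i, (i <= m)%nat -> P i x) /\ P (S m) x)).
    + intros x [Hx HSm] i Hi. destruct (Nat.eq_dec i (S m)) as [->|]; auto with arith.
      apply Hx. lia.
    + apply filter_and; [apply IH; auto with arith | apply H; lia].
Qed.

Lemma is_lim_gt_0_near (f : R -> R) (x : Rbar) (l : R) :
  is_lim f x l -> 0 < l -> Rbar_locally' x (fun y => 0 < f y).
Proof.
  intros Hf Hl. apply is_lim_spec in Hf.
  apply (filter_imp (fun y => Rabs (f y - l) < l)); [|exact (Hf (mkposreal l Hl))].
  intros y Hy. apply Rabs_def2 in Hy. lra.
Qed.

Lemma is_lim_ln_1_plus_div (a : R) : is_lim (fun e => ln (1 + a * e) / e) 0 a.
Proof.
  assert (Hd : derivable_pt_lim (fun e => ln (1 + a * e)) 0 a).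
  { apply is_derive_Reals. auto_derive; [lra | field]. }
  apply is_lim_spec. intros eps. destruct (Hd eps (cond_pos eps)) as [del Hdel].
  exists del. intros y Hy Hy0. change (Rabs (y - 0) < del) in Hy. rewrite Rminus_0_r in Hy.
  specialize (Hdel y Hy0 Hy).
  rewrite Rplus_0_l, Rmult_0_r, Rplus_0_r, ln_1, Rminus_0_r in Hdel. exact Hdel.
Qed.

(** * Concavity of [y ^ (1 - alpha)] *)

Section PowerFunction.

Variable al : R.
Hypothesis Hal : 0 < al < 1.

Definition pw x := Rpower x (1 - al).
Definition pw' x := (1 - al) * Rpower x (- al).
Definition pw'' x := (1 - al) * (- al) * Rpower x (- al - 1).
Definition pw_prim x := Rpower x (2 - al) / (2 - al).
Definition pw_incr y := pw (y + 1) - pw y.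
Definition trap_err y := pw_prim (y + 1) - pw_prim y - (pw (y + 1) + pw y) / 2.

Lemma is_derive_pw x : 0 < x -> is_derive pw x (pw' x).
Proof.
  intros Hx. unfold pw'. replace (- al) with (1 - al - 1) by ring.
  exact (is_derive_Rpower _ _ Hx).
Qed.

Lemma is_derive_pw' x : 0 < x -> is_derive pw' x (pw'' x).
Proof.
  intros Hx. unfold pw'', pw'. rewrite Rmult_assoc.
  apply is_derive_scal. exact (is_derive_Rpower _ _ Hx).
Qed.

Lemma pw'_gt_0 x : 0 < pw' x.
Proof. apply Rmult_lt_0_compat; [lra | apply Rpower_gt_0]. Qed.

Lemma pw'_decreasing u v : 0 < u < v -> pw' v < pw' u.
Proof.
  intros Huv. apply Rmult_lt_compat_l; [lra|]. apply Rpower_opp_decreasing; lra.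
Qed.

Lemma pw''_increasing u v : 0 < u < v -> pw'' u < pw'' v.
Proof.
  intros Huv. unfold pw''. replace (- al - 1) with (- (al + 1)) by ring.
  assert (Rpower v (- (al + 1)) < Rpower u (- (al + 1))) by (apply Rpower_opp_decreasing; lra).
  assert (0 < (1 - al) * al) by nra. nra.
Qed.

Lemma pw'_step_antitone u v : 0 < u -> u <= v <= u + 1 ->
  pw' v - pw' (v + 1) <= pw' u - pw' (u + 1).
Proof.
  intros Hu Huv. destruct (Req_dec u v) as [<-|Huv']; [lra|].
  destruct (MVT_cor2 pw' pw'' u v) as [c1 [E1 H1]]; [lra| |].
  { intros c Hc. apply is_derive_Reals, is_derive_pw'. lra. }
  destruct (MVT_cor2 pw' pw'' (u + 1) (v + 1)) as [c2 [E2 H2]]; [lra| |].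
  { intros c Hc. apply is_derive_Reals, is_derive_pw'. lra. }
  assert (pw'' c1 < pw'' c2) by (apply pw''_increasing; lra).
  replace (v + 1 - (u + 1)) with (v - u) in E2 by ring. nra.
Qed.

Ltac solve_pw_derive :=
  unfold pw, pw_prim, pw'; auto_derive;
  [ repeat first [ split | exact I | eexists; apply is_derive_Rpower; lra ]
  | rewrite ?Derive_Rpower by lra;
    try replace (2 - al - 1) with (1 - al) by ring;
    try replace (1 - al - 1) with (- al) by ring;
    unfold Rminus; field; lra ].

Definition trap_err_profile m s :=
  - s * pw (m - s) - pw_prim (m - s) - s * pw (m + s) + pw_prim (m + s).

Lemma trap_err_profile_ends y :
  trap_err y = trap_err_profile (y + 1/2) (1/2) - trap_err_profile (y + 1/2) 0.
Proof.
  unfold trap_err, trap_err_profile.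
  replace (y + 1/2 - 1/2) with y by field. replace (y + 1/2 + 1/2) with (y + 1) by field.
  rewrite Rminus_0_r, Rplus_0_r. field.
Qed.

Lemma is_derive_trap_err_profile m t : 0 <= t <= 1/2 -> 1/2 < m ->
  is_derive (trap_err_profile m) t (t * pw' (m - t) - t * pw' (m + t)).
Proof. intros Ht Hm. unfold trap_err_profile. solve_pw_derive. Qed.

Lemma trap_err_gt_0 y : 0 < y -> 0 < trap_err y.
Proof.
  intros Hy. rewrite trap_err_profile_ends.
  enough (trap_err_profile (y + 1/2) 0 < trap_err_profile (y + 1/2) (1/2)) by lra.
  apply (lt_of_derive_pos _ (fun t => t * pw' (y + 1/2 - t) - t * pw' (y + 1/2 + t)));
    [lra | intros; apply is_derive_trap_err_profile; lra |].
  intros t Ht. assert (pw' (y + 1/2 + t) < pw' (y + 1/2 - t)) by (apply pw'_decreasing; lra).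
  nra.
Qed.

Lemma trap_err_succ_le y : 0 < y -> trap_err (y + 1) <= trap_err y.
Proof.
  intros Hy. rewrite !trap_err_profile_ends.
  replace (y + 1 + 1/2) with (y + 3/2) by field.
  enough (trap_err_profile (y + 1/2) 0 - trap_err_profile (y + 3/2) 0
          <= trap_err_profile (y + 1/2) (1/2) - trap_err_profile (y + 3/2) (1/2)) by lra.
  apply (le_of_derive_nonneg (fun s => trap_err_profile (y + 1/2) s - trap_err_profile (y + 3/2) s)
           (fun t => (t * pw' (y + 1/2 - t) - t * pw' (y + 1/2 + t))
                     - (t * pw' (y + 3/2 - t) - t * pw' (y + 3/2 + t))) 0 (1/2)); [lra| |].
  - intros t Ht. apply (is_derive_minus (trap_err_profile (y + 1/2)));
      apply is_derive_trap_err_profile; lra.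
  - intros t Ht. assert (G := pw'_step_antitone (y + 1/2 - t) (y + 1/2 + t) ltac:(lra) ltac:(lra)).
    replace (y + 1/2 - t + 1) with (y + 3/2 - t) in G by field.
    replace (y + 1/2 + t + 1) with (y + 3/2 + t) in G by field. nra.
Qed.

Lemma trap_err_lt_pw_incr y : 0 < y -> trap_err y < pw_incr y.
Proof.
  intros Hy.
  set (H := fun t => pw (y + t) * (1/2 + t) - pw_prim (y + t)).
  assert (HH : H 0 < H 1).
  { apply (lt_of_derive_pos _ (fun t => pw' (y + t) * (1/2 + t))); [lra | |].
    - intros t Ht. unfold H. solve_pw_derive.
    - intros t Ht. pose proof (pw'_gt_0 (y + t)). nra. }
  unfold H in HH. rewrite Rplus_0_r in HH. unfold pw_incr, trap_err. lra.
Qed.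

Lemma pw_incr_trap_err_combination_gt_0 y : 0 < y ->
  0 < pw_incr y - pw_incr (y + 1) + 2 * trap_err (y + 1) - trap_err y - trap_err (y + 1 + 1).
Proof.
  intros Hy.
  set (H := fun t => pw (y + t) * (1/2 + t) - pw_prim (y + t)
    - (pw (y + 1 + t) * (1/2 + t) - pw_prim (y + 1 + t))
    + (pw (y + 1 + t) * (1/2 - t) + pw_prim (y + 1 + t))
    - (pw (y + 1 + 1 + t) * (1/2 - t) + pw_prim (y + 1 + 1 + t))).
  assert (HH : H 0 < H 1).
  { apply (lt_of_derive_pos _ (fun t => (pw' (y + t) - pw' (y + 1 + t)) * (1/2 + t)
                                      + (pw' (y + 1 + t) - pw' (y + 1 + 1 + t)) * (1/2 - t)));
      [lra | intros t Ht; unfold H; solve_pw_derive |].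
    intros t Ht.
    assert (G := pw'_step_antitone (y + t) (y + t + 1) ltac:(lra) ltac:(lra)).
    replace (y + t + 1) with (y + 1 + t) in G by ring.
    replace (y + 1 + t + 1) with (y + 1 + 1 + t) in G by ring.
    assert (pw' (y + 1 + 1 + t) < pw' (y + 1 + t)) by (apply pw'_decreasing; lra).
    assert (pw' (y + 1 + t) < pw' (y + t)) by (apply pw'_decreasing; lra).
    destruct (Rle_dec t (1/2)); nra. }
  unfold H in HH. rewrite !Rplus_0_r in HH. unfold pw_incr, trap_err. lra.
Qed.

Lemma pw_incr_last_ineq s : 0 < s < 1 -> s * s * pw_incr s < (1 - al) * (trap_err s + pw s).
Proof.
  intros Hs.
  destruct (MVT_cor2 pw pw' s (s + 1)) as [c [E1 H1]]; [lra| |].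
  { intros c Hc. apply is_derive_Reals, is_derive_pw. lra. }
  assert (Hc : pw' c < pw' s) by (apply pw'_decreasing; lra).
  assert (HB := trap_err_gt_0 s ltac:(lra)).
  assert (HF : (1 - al) * pw s = s * pw' s).
  { unfold pw, pw'. replace (1 - al) with (1 + - al) at 2 by ring.
    rewrite Rpower_plus, Rpower_1 by lra. ring. }
  pose proof (pw'_gt_0 c).
  unfold pw_incr. replace (s + 1 - s) with 1 in E1 by ring. rewrite E1.
  assert (0 <= s * (1 - s) * pw' c) by (apply Rmult_le_pos; [nra | lra]).
  nra.
Qed.

End PowerFunction.

(** * The L2-1_sigma coefficients for small [tau] *)

Lemma continuous_Rpower_pos_part (a z : R) : 0 < a -> 0 <= z ->
  continuous (fun x => if Rle_dec x 0 then 0 else Rpower x a) z.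
Proof.
  intros Ha Hz. apply continuity_pt_filterlim. destruct (Req_dec z 0) as [->|Hz0].
  - intros eps Heps. exists (Rpower eps (/ a)). split; [apply Rpower_gt_0|].
    intros x [_ Hx]. cbn in Hx |- *. unfold R_dist in Hx |- *. rewrite Rminus_0_r in Hx.
    destruct (Rle_dec 0 0) as [_|]; [|lra]. destruct (Rle_dec x 0); rewrite Rminus_0_r.
    + rewrite Rabs_R0. lra.
    + rewrite Rabs_right in Hx |- * by (try apply Rle_ge, Rlt_le, Rpower_gt_0; lra).
      replace eps with (Rpower (Rpower eps (/ a)) a)
        by (rewrite Rpower_mult, Rinv_l, Rpower_1 by lra; reflexivity).
      apply Rlt_Rpower_l; lra.
  - apply (continuity_pt_locally_ext (fun x => Rpower x a) _ z z); [lra| |].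
    + intros y Hy. unfold Rdist in Hy. destruct (Rle_dec y 0); [|reflexivity].
      rewrite Rabs_left1 in Hy; lra.
    + apply derivable_continuous_pt. exists (a * Rpower z (a - 1)).
      apply derivable_pt_lim_power. lra.
Qed.

Lemma ex_RInt_gamma_integrand (s b : R) : 1 < s -> 0 <= b ->
  ex_RInt (fun x => Rpower x (s - 1) * exp (- x)) 0 b.
Proof.
  intros Hs Hb.
  (* [Rpower 0 _ = 1], so the integrand is continuous only after redefining it at [0] *)
  apply (ex_RInt_ext (fun x => (if Rle_dec x 0 then 0 else Rpower x (s - 1)) * exp (- x))).
  - intros x Hx. rewrite Rmin_left, Rmax_right in Hx by lra.
    destruct (Rle_dec x 0); [lra | reflexivity].
  - apply (@ex_RInt_continuous R_CompleteNormedModule). intros z Hz.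
    rewrite Rmin_left, Rmax_right in Hz by lra.
    apply (continuous_mult (fun x => if Rle_dec x 0 then 0 else Rpower x (s - 1))
                           (fun x => exp (- x))).
    + apply continuous_Rpower_pos_part; lra.
    + apply (ex_derive_continuous (fun x => exp (- x))). auto_derive. exact I.
Qed.

Lemma Gamma_ge_0 (s : R) : 1 < s -> 0 <= Gamma s.
Proof.
  intros Hs. unfold Gamma.
  set (I n := RInt (fun x => Rpower x (s - 1) * exp (- x)) 0 (INR n)).
  assert (HI : forall n, 0 <= I n).
  { intros n. apply RInt_ge_0; [apply pos_INR | apply ex_RInt_gamma_integrand, pos_INR; lra |].
    intros x _. apply Rmult_le_pos; apply Rlt_le; [apply Rpower_gt_0 | apply exp_pos]. }
  assert (HL : Rbar_le (Lim_seq (fun _ => 0)) (Lim_seq I)).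
  { apply Lim_seq_le_loc. exists 0%nat. intros n _. apply HI. }
  rewrite Lim_seq_const in HL.
  destruct (Lim_seq I); cbn in HL |- *; lra.
Qed.

Definition strictly_admissible (s : R) (k : nat) (c : nat -> R) : Prop :=
  0 < c 1%nat /\ (forall i, (2 <= i <= k)%nat -> c (pred i) < c i) /\
  ((1 <= k)%nat -> s * s * c k < (2 * s - 1) * c (S k)).

Lemma admissible_scale (s lam : R) (k : nat) (c c' : nat -> R) : 0 <= lam ->
  (forall i, c' i = lam * c i) -> admissible s k c -> admissible s k c'.
Proof.
  intros Hlam Hc' [H1 [H2 H3]]. split; [|split].
  - rewrite Hc'. now apply Rmult_le_pos.
  - intros i Hi. rewrite !Hc'. apply Rmult_le_compat_l; auto.
  - intros Hk. rewrite !Hc'. specialize (H3 Hk). nra.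
Qed.

Lemma admissible_near (s : R) (k : nat) (c : R -> nat -> R) (c0 : nat -> R) (x : Rbar) :
  (forall i, (1 <= i <= S k)%nat -> is_lim (fun e => c e i) x (c0 i)) ->
  strictly_admissible s k c0 -> Rbar_locally' x (fun e => admissible s k (c e)).
Proof.
  intros Hlim [H1 [H2 H3]].
  assert (N1 : Rbar_locally' x (fun e => 0 < c e 1%nat))
    by exact (is_lim_gt_0_near _ _ _ (Hlim 1%nat ltac:(lia)) H1).
  assert (N2 : Rbar_locally' x (fun e => forall i, (i <= k)%nat -> (2 <= i)%nat ->
                                       0 < c e i - c e (pred i))).
  { apply filter_forall_le. intros i Hi. destruct (le_lt_dec 2 i) as [H2i|H2i].
    - apply (filter_imp (fun e => 0 < c e i - c e (pred i))); [auto|].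
      apply (is_lim_gt_0_near _ _ (c0 i - c0 (pred i))); [|specialize (H2 i ltac:(lia)); lra].
      apply is_lim_minus'; apply Hlim; lia.
    - apply filter_forall. intros e He. lia. }
  assert (N3 : Rbar_locally' x (fun e => (1 <= k)%nat ->
                                       0 < (2 * s - 1) * c e (S k) - s * s * c e k)).
  { destruct (le_lt_dec 1 k) as [Hk|Hk].
    - apply (filter_imp (fun e => 0 < (2 * s - 1) * c e (S k) - s * s * c e k)); [auto|].
      apply (is_lim_gt_0_near _ _ ((2 * s - 1) * c0 (S k) - s * s * c0 k));
        [|specialize (H3 Hk); lra].
      apply is_lim_minus'; apply is_lim_mult_fin;
        [apply is_lim_const | apply Hlim; lia | apply is_lim_const | apply Hlim; lia].
    - apply filter_forall. intros e He. lia. }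
  generalize (filter_and _ _ N1 (filter_and _ _ N2 N3)). apply filter_imp.
  intros e [E1 [E2 E3]]. split; [|split].
  - lra.
  - intros i Hi. specialize (E2 i ltac:(lia) ltac:(lia)). lra.
  - intros Hk. specialize (E3 Hk). lra.
Qed.

(* [c_coef] for [k >= 1] in terms of the log-distances [d j = ln (t_(k+sigma) / t_j)],
   so that [ln (t_i / t_j) = d j - d i]; the factor [1 / Gamma (2 - alpha)] is left out *)
Definition a_dist (al : R) (d : nat -> R) (i : nat) : R :=
  Rpower (d (pred i)) (1 - al) - Rpower (d i) (1 - al).

Definition b_dist (al : R) (d : nat -> R) (i : nat) : R :=
  / (d (pred i) - d (S i)) *
  (2 / (2 - al) * (Rpower (d (pred i)) (2 - al) - Rpower (d i) (2 - al))
   - (d (pred i) - d i) * (Rpower (d i) (1 - al) + Rpower (d (pred i)) (1 - al))).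

Definition c_dist (al : R) (k : nat) (d : nat -> R) (i : nat) : R :=
  if Nat.eqb i 1 then (a_dist al d 1 - b_dist al d 1) / (d 0%nat - d 1%nat)
  else if andb (2 <=? i)%nat (i <=? k)%nat then
    (a_dist al d i + b_dist al d (pred i) - b_dist al d i) / (d (pred i) - d i)
  else if Nat.eqb i (S k) then (b_dist al d k + Rpower (d k) (1 - al)) / (d k - d (S k))
  else 0.

Lemma c_coef_eq_c_dist al sg ta tau k i : 0 < ta -> 0 < tau -> 0 < sg ->
  c_coef al sg ta tau i (S k)
  = / Gamma (2 - al)
    * c_dist al (S k) (fun j => ln (tgrid ta tau (INR (S k) + sg) / tgrid ta tau (INR j))) i.
Proof.
  intros Hta Htau Hsg.
  set (D := fun j => ln (tgrid ta tau (INR (S k) + sg) / tgrid ta tau (INR j))).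
  assert (Ht : forall x, 0 <= x -> 0 < tgrid ta tau x) by (intros; unfold tgrid; nra).
  assert (HD : forall a b, ln (tgrid ta tau (INR a) / tgrid ta tau (INR b)) = D b - D a).
  { intros a b. unfold D.
    assert (0 < tgrid ta tau (INR (S k) + sg)) by (apply Ht; pose proof (pos_INR (S k)); lra).
    pose proof (Ht _ (pos_INR a)). pose proof (Ht _ (pos_INR b)).
    rewrite !ln_div by lra. ring. }
  assert (Hb : forall j, b_coef al sg ta tau j (S k) = b_dist al D j).
  { intros j. unfold b_coef, b_dist. cbv zeta. rewrite !HD. reflexivity. }
  assert (Hdiv : forall x G l, x / (G * l) = / G * (x / l)).
  { intros. unfold Rdiv. rewrite Rinv_mult. ring. }
  assert (Ha : forall j, a_coef al sg ta tau j (S k) = a_dist al D j) by reflexivity.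
  unfold c_coef, c_dist. cbv zeta. rewrite !Hb, !Ha.
  destruct (Nat.eqb i 1).
  - rewrite Hdiv. do 3 f_equal. exact (HD 1%nat 0%nat).
  - destruct (andb _ _); [|destruct (Nat.eqb i (S (S k)))]; rewrite ?Hdiv, ?HD;
      [reflexivity .. | ring].
Qed.

Lemma a_dist_scale al d lam i : 0 < lam -> 0 < d (pred i) -> 0 < d i ->
  a_dist al (fun j => lam * d j) i = Rpower lam (1 - al) * a_dist al d i.
Proof. intros. unfold a_dist. rewrite <- !Rpower_mult_distr by auto. ring. Qed.

Lemma b_dist_scale al d lam i : 0 < lam -> 0 < d (pred i) -> 0 < d i -> al < 2 ->
  b_dist al (fun j => lam * d j) i = Rpower lam (1 - al) * b_dist al d i.
Proof.
  intros. unfold b_dist. rewrite <- !Rpower_mult_distr by auto.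
  replace (2 - al) with (1 + (1 - al)) by ring. rewrite !Rpower_1_plus by auto.
  replace (lam * d (pred i) - lam * d (S i)) with (lam * (d (pred i) - d (S i))) by ring.
  rewrite Rinv_mult. set (inv_gap := / (d (pred i) - d (S i))). field. lra.
Qed.

Lemma c_dist_scale al k d lam i : 0 < al < 1 -> 0 < lam -> (1 <= k)%nat ->
  (forall j, (j <= k)%nat -> 0 < d j) ->
  c_dist al k (fun j => lam * d j) i = Rpower lam (1 - al) / lam * c_dist al k d i.
Proof.
  intros Hal Hl Hk Hd.
  assert (Hdiff : forall a b, lam * d a - lam * d b = lam * (d a - d b)) by (intros; ring).
  unfold c_dist. rewrite !Hdiff.
  destruct (Nat.eqb i 1) eqn:E1; [|destruct (andb _ _) eqn:E2; [|destruct (Nat.eqb i (S k))]].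
  - rewrite a_dist_scale, b_dist_scale by (try apply Hd; cbn; lia || lra).
    unfold Rdiv. rewrite Rinv_mult. set (inv_gap := / (_ - _)). field. lra.
  - apply andb_true_iff in E2 as [E2 E3]. apply Nat.leb_le in E2, E3.
    rewrite a_dist_scale, !b_dist_scale by (try apply Hd; lia || lra).
    unfold Rdiv. rewrite Rinv_mult. set (inv_gap := / (_ - _)). field. lra.
  - rewrite b_dist_scale, <- Rpower_mult_distr by (try apply Hd; lia || lra).
    unfold Rdiv. rewrite Rinv_mult. set (inv_gap := / (_ - _)). field. lra.
  - ring.
Qed.

Lemma is_lim_c_dist al k (d : R -> nat -> R) (d0 : nat -> R) (x : Rbar) i :
  (1 <= k)%nat -> (1 <= i <= S k)%nat ->
  (forall j, is_lim (fun e => d e j) x (d0 j)) ->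
  (forall j, (j <= k)%nat -> 0 < d0 j) -> (forall j, d0 j - d0 (S j) = 1) ->
  is_lim (fun e => c_dist al k (d e) i) x (c_dist al k d0 i).
Proof.
  intros Hk Hi Hd Hpos Hstep.
  assert (Hgap2 : forall j, (1 <= j)%nat -> d0 (pred j) - d0 (S j) <> 0).
  { intros [|j] Hj; [lia|]. cbn. pose proof (Hstep j). pose proof (Hstep (S j)). lra. }
  assert (Hgap1 : forall j, d0 j - d0 (S j) <> 0) by (intros j; rewrite Hstep; lra).
  unfold c_dist. destruct (Nat.eqb i 1) eqn:E1;
    [|destruct (andb _ _) eqn:E2; [|destruct (Nat.eqb i (S k))]]; [| | |apply is_lim_const].
  - unfold a_dist, b_dist.
    solve_is_lim Hd; first [apply Hpos; cbn; lia | apply Hgap2; lia | apply Hgap1].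
  - apply andb_true_iff in E2 as [E2 E3]. apply Nat.leb_le in E2, E3.
    replace i with (S (pred i)) by lia. unfold a_dist, b_dist.
    solve_is_lim Hd; first [apply Hpos; cbn; lia | apply Hgap2; lia | apply Hgap1].
  - unfold a_dist, b_dist.
    solve_is_lim Hd; first [apply Hpos; lia | apply Hgap2; lia | apply Hgap1].
Qed.

Lemma a_dist_unit_steps al d i x : d (pred i) = x + 1 -> d i = x -> a_dist al d i = pw_incr al x.
Proof. intros E1 E2. unfold a_dist, pw_incr, pw. now rewrite E1, E2. Qed.

Lemma b_dist_unit_steps al d i x : al < 2 ->
  d (pred i) = x + 1 -> d i = x -> d (S i) = x - 1 -> b_dist al d i = trap_err al x.
Proof.
  intros Hal E1 E2 E3. unfold b_dist, trap_err, pw_prim, pw. rewrite E1, E2, E3.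
  replace (x + 1 - (x - 1)) with 2 by ring. replace (x + 1 - x) with 1 by ring. field. lra.
Qed.

Section UniformGrid.

Variables (al : R) (k : nat).
Hypotheses (Hal : 0 < al < 1) (Hk : (1 <= k)%nat).

Definition unif_dist (j : nat) : R := INR k + (1 - al / 2) - INR j.

Lemma unif_dist_S j : unif_dist (S j) = unif_dist j - 1.
Proof. unfold unif_dist. rewrite S_INR. ring. Qed.

Lemma unif_dist_pred j : (1 <= j)%nat -> unif_dist (pred j) = unif_dist j + 1.
Proof. intros Hj. destruct j as [|j]; [lia|]. cbn [pred]. rewrite unif_dist_S. ring. Qed.

Lemma unif_dist_gt_0 j : (j <= k)%nat -> 0 < unif_dist j.
Proof. intros Hj. unfold unif_dist. apply le_INR in Hj. lra. Qed.

Lemma c_dist_unif_1 :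
  c_dist al k unif_dist 1 = pw_incr al (unif_dist 1) - trap_err al (unif_dist 1).
Proof.
  assert (E0 : unif_dist 0 = unif_dist 1 + 1) by (rewrite (unif_dist_S 0); ring).
  unfold c_dist. cbn [Nat.eqb].
  rewrite (a_dist_unit_steps al unif_dist 1 _ E0 eq_refl),
    (b_dist_unit_steps al unif_dist 1 _ ltac:(lra) E0 eq_refl (unif_dist_S 1)), E0.
  replace (unif_dist 1 + 1 - unif_dist 1) with 1 by ring. field.
Qed.

Lemma c_dist_unif_mid i : (2 <= i <= k)%nat ->
  c_dist al k unif_dist i
  = pw_incr al (unif_dist i) + trap_err al (unif_dist i + 1) - trap_err al (unif_dist i).
Proof.
  intros Hi. unfold c_dist.
  replace (Nat.eqb i 1) with false by (symmetry; apply Nat.eqb_neq; lia).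
  replace (andb (2 <=? i)%nat (i <=? k)%nat) with true
    by (symmetry; apply andb_true_iff; split; apply Nat.leb_le; lia).
  assert (E0 : unif_dist (pred i) = unif_dist i + 1) by (apply unif_dist_pred; lia).
  assert (E1 : unif_dist (pred (pred i)) = unif_dist i + 1 + 1)
    by (rewrite !unif_dist_pred by lia; ring).
  assert (E2 : unif_dist (S (pred i)) = unif_dist i + 1 - 1)
    by (replace (S (pred i)) with i by lia; ring).
  rewrite (a_dist_unit_steps al unif_dist i _ E0 eq_refl),
    (b_dist_unit_steps al unif_dist i _ ltac:(lra) E0 eq_refl (unif_dist_S i)),
    (b_dist_unit_steps al unif_dist (pred i) _ ltac:(lra) E1 E0 E2), E0.
  replace (unif_dist i + 1 - unif_dist i) with 1 by ring. field.
Qed.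

Lemma c_dist_unif_last :
  c_dist al k unif_dist (S k) = trap_err al (unif_dist k) + pw al (unif_dist k).
Proof.
  unfold c_dist.
  replace (Nat.eqb (S k) 1) with false by (symmetry; apply Nat.eqb_neq; lia).
  replace (andb (2 <=? S k)%nat (S k <=? k)%nat) with false
    by (symmetry; apply andb_false_iff; right; apply Nat.leb_gt; lia).
  rewrite Nat.eqb_refl.
  assert (E0 : unif_dist (pred k) = unif_dist k + 1) by (apply unif_dist_pred; lia).
  rewrite (b_dist_unit_steps al unif_dist k _ ltac:(lra) E0 eq_refl (unif_dist_S k)), unif_dist_S.
  replace (unif_dist k - (unif_dist k - 1)) with 1 by ring. unfold pw. field.
Qed.

Lemma unif_strictly_admissible : strictly_admissible (1 - al / 2) k (c_dist al k unif_dist).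
Proof.
  set (s := 1 - al / 2).
  assert (Hk_dist : unif_dist k = s) by (unfold unif_dist, s; ring).
  split; [|split].
  - rewrite c_dist_unif_1. apply Rlt_0_minus, trap_err_lt_pw_incr; auto.
    apply unif_dist_gt_0; lia.
  - intros i Hi. rewrite (c_dist_unif_mid i Hi).
    assert (Hy : 0 < unif_dist i) by (apply unif_dist_gt_0; lia).
    pose proof (pw_incr_trap_err_combination_gt_0 al Hal _ Hy) as Hgap.
    destruct (Nat.eq_dec i 2) as [->|Hi2].
    + cbn [pred]. rewrite c_dist_unif_1.
      replace (unif_dist 1) with (unif_dist 2 + 1) by (rewrite (unif_dist_S 1); ring).
      pose proof (trap_err_gt_0 al Hal (unif_dist 2 + 1 + 1) ltac:(lra)). lra.
    + rewrite (c_dist_unif_mid (pred i)), unif_dist_pred by lia. lra.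
  - intros _. fold s. rewrite c_dist_unif_last, Hk_dist.
    replace (2 * s - 1) with (1 - al) by (unfold s; field).
    assert (Hs : 0 < s < 1) by (unfold s; lra).
    pose proof (pw_incr_last_ineq al Hal s Hs).
    assert (c_dist al k unif_dist k <= pw_incr al s).
    { destruct (Nat.eq_dec k 1) as [Ek|Ek].
      - replace (c_dist al k unif_dist k) with (c_dist al k unif_dist 1)
          by (f_equal; symmetry; exact Ek).
        rewrite Ek in Hk_dist. rewrite c_dist_unif_1, Hk_dist.
        pose proof (trap_err_gt_0 al Hal s ltac:(lra)). lra.
      - rewrite c_dist_unif_mid, Hk_dist by lia.
        pose proof (trap_err_succ_le al Hal s ltac:(lra)). lra. }
    nra.
Qed.

End UniformGrid.

Definition scaled_dist (x0 e : R) (j : nat) : R := (ln (1 + x0 * e) - ln (1 + INR j * e)) / e.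

Lemma is_lim_scaled_dist x0 j : is_lim (fun e => scaled_dist x0 e j) 0 (x0 - INR j).
Proof.
  apply (is_lim_ext (fun e => ln (1 + x0 * e) / e - ln (1 + INR j * e) / e)).
  - intros e. unfold scaled_dist, Rdiv. ring.
  - apply is_lim_minus'; apply is_lim_ln_1_plus_div.
Qed.

Lemma scaled_dist_gt_0 x0 e j : 0 < e -> INR j < x0 -> 0 < scaled_dist x0 e j.
Proof.
  intros He Hj. pose proof (pos_INR j). unfold scaled_dist.
  apply Rdiv_lt_0_compat; [|exact He]. apply Rlt_0_minus, ln_increasing; nra.
Qed.

(* with [e = tau / ta], [ln (t_(k+sigma) / t_j) = e * scaled_dist (k + sigma) e j]; [c_dist] is
   homogeneous of degree [- alpha] *)
Lemma c_coef_eq_scaled al sg ta tau k i : 0 < al < 1 -> 0 < ta -> 0 < tau -> 0 < sg ->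
  let e := tau / ta in
  c_coef al sg ta tau i (S k)
  = / Gamma (2 - al) * (Rpower e (1 - al) / e)
    * c_dist al (S k) (scaled_dist (INR (S k) + sg) e) i.
Proof.
  intros Hal Hta Htau Hsg e. assert (He : 0 < e) by (apply Rdiv_lt_0_compat; assumption).
  rewrite c_coef_eq_c_dist by assumption.
  replace (fun j => ln (tgrid ta tau (INR (S k) + sg) / tgrid ta tau (INR j)))
    with (fun j => e * scaled_dist (INR (S k) + sg) e j).
  - assert (Hpos : forall j, (j <= S k)%nat -> 0 < scaled_dist (INR (S k) + sg) e j).
    { intros j Hj. apply scaled_dist_gt_0; [exact He|]. apply le_INR in Hj. lra. }
    rewrite c_dist_scale by (lia || assumption). ring.
  - apply functional_extensionality. intros j.
    assert (Ht : forall x, 0 <= x -> ta + x * tau = ta * (1 + x * e))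
      by (intros; unfold e; field; lra).
    assert (Hp : forall x, 0 <= x -> 0 < 1 + x * e) by (intros; nra).
    assert (Hx0 : 0 <= INR (S k) + sg) by (pose proof (pos_INR (S k)); lra).
    pose proof (pos_INR j).
    unfold tgrid. rewrite !Ht by assumption.
    rewrite ln_div, !ln_mult by (try apply Rmult_lt_0_compat; auto).
    unfold scaled_dist. field. lra.
Qed.

Lemma inv_Gamma_ge_0 s : 1 < s -> 0 <= / Gamma s.
Proof.
  intros Hs. destruct (Req_dec (Gamma s) 0) as [->|HG]; [rewrite Rinv_0; lra|].
  pose proof (Gamma_ge_0 s Hs). apply Rlt_le, Rinv_0_lt_compat. lra.
Qed.

Lemma c_coef_0_admissible al ta tau : 0 < al < 1 -> 0 < ta -> 0 < tau ->
  admissible (1 - al / 2) 0 (fun i => c_coef al (1 - al / 2) ta tau i 0).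
Proof.
  intros Hal Hta Htau. split; [|split]; [|lia ..].
  unfold c_coef; cbn [Nat.eqb].
  replace (tgrid ta tau 1 / tgrid ta tau 0) with (1 + tau / ta) by (unfold tgrid; field; lra).
  assert (Hln : 0 < ln (1 + tau / ta)).
  { rewrite <- ln_1. apply ln_increasing; [lra|].
    pose proof (Rdiv_lt_0_compat tau ta Htau Hta). lra. }
  unfold Rdiv. rewrite Rinv_mult.
  apply Rmult_le_pos; [apply Rlt_le, Rpower_gt_0 |].
  apply Rmult_le_pos; [apply inv_Gamma_ge_0; lra | now apply Rlt_le, Rinv_0_lt_compat].
Qed.

Lemma c_coef_S_admissible_small_tau al ta k : 0 < al < 1 -> 0 < ta ->
  exists tau0, 0 < tau0 /\ forall tau, 0 < tau < tau0 ->
    admissible (1 - al / 2) (S k) (fun i => c_coef al (1 - al / 2) ta tau i (S k)).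
Proof.
  intros Hal Hta. set (sg := 1 - al / 2). set (x0 := INR (S k) + sg).
  assert (Hnear := admissible_near sg (S k) (fun e => c_dist al (S k) (scaled_dist x0 e))
                     (c_dist al (S k) (unif_dist al (S k))) 0).
  destruct Hnear as [eps Heps].
  { intros i Hi. apply is_lim_c_dist; [lia | exact Hi | apply is_lim_scaled_dist | |].
    - intros j Hj. apply unif_dist_gt_0; [exact Hal | lia].
    - intros j. rewrite unif_dist_S. ring. }
  { apply unif_strictly_admissible; [exact Hal | lia]. }
  exists (eps * ta). split; [apply Rmult_lt_0_compat; [apply cond_pos | exact Hta]|].
  intros tau Htau. set (e := tau / ta).
  assert (He : 0 < e < eps).
  { unfold e. split; [apply Rdiv_lt_0_compat; lra|].
    apply Rmult_lt_reg_r with ta; [exact Hta|]. field_simplify; lra. }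
  apply (admissible_scale _ (/ Gamma (2 - al) * (Rpower e (1 - al) / e)) _
           (c_dist al (S k) (scaled_dist x0 e))).
  - apply Rmult_le_pos; [apply inv_Gamma_ge_0; lra|].
    apply Rlt_le, Rdiv_lt_0_compat; [apply Rpower_gt_0 | lra].
  - intros i. apply c_coef_eq_scaled; unfold sg; lra.
  - apply Heps; [|lra]. change (Rabs (e - 0) < eps).
    rewrite Rminus_0_r, Rabs_pos_eq; lra.
Qed.

Lemma c_coef_admissible_small_tau al ta k : 0 < al < 1 -> 0 < ta ->
  exists tau0, 0 < tau0 /\ forall tau, 0 < tau < tau0 ->
    admissible (1 - al / 2) k (fun i => c_coef al (1 - al / 2) ta tau i k).
Proof.
  intros Hal Hta. destruct k as [|k]; [|now apply c_coef_S_admissible_small_tau].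
  exists 1. split; [lra|]. intros tau Htau. apply c_coef_0_admissible; lra.
Qed.

Theorem lemma3p2 (alpha : R) (Halpha : 0 < alpha < 1) (ta T : R)
  (Hat : 0 < ta) (HT : ta < T) (k : nat) :
  let sigma := 1 - alpha / 2 in
  exists tau0 : R, 0 < tau0 /\
  forall N : nat, (0 < N)%nat -> (k < N)%nat ->
  let tau := (T - ta) / INR N in
  tau < tau0 ->
  let c := fun i => c_coef alpha sigma ta tau i k in
  (forall (a b : R) (M : nat), a < b -> (0 < M)%nat ->
     let h := (b - a) / INR M in
     forall v : nat -> nat -> R,
       sum_n_m (fun i => c i * ip1 h M (fun j => v i j - v (pred i) j)
                  (fun j => sigma * v (S k) j + (1 - sigma) * v k j)) 1 (S k)
       >= 1 / 2 * sum_n_m (fun i => c i * (ip1 h M (v i) (v i)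
                                         - ip1 h M (v (pred i)) (v (pred i)))) 1 (S k))
  /\
  (forall (L : R) (M : nat), 0 < L -> (0 < M)%nat ->
     let h := 2 * L / INR M in
     forall w : nat -> nat -> nat -> R,
       (forall n : nat, (n <= S k)%nat -> zero_boundary M (w n)) ->
       sum_n_m (fun i => c i * ip2 h M (fun j l => w i j l - w (pred i) j l)
                  (fun j l => sigma * w (S k) j l + (1 - sigma) * w k j l)) 1 (S k)
       >= 1 / 2 * sum_n_m (fun i => c i * (ip2 h M (w i) (w i)
                                         - ip2 h M (w (pred i)) (w (pred i)))) 1 (S k)).
Proof.
  intros sigma.
  destruct (c_coef_admissible_small_tau alpha ta k Halpha Hat) as [tau0 [Htau0 Hadm]].
  exists tau0. split; [exact Htau0|].
  intros N HN _ tau Htau c.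
  assert (Hc : admissible sigma k c).
  { apply Hadm. split; [|exact Htau].
    apply Rdiv_lt_0_compat; [lra | apply lt_0_INR; lia]. }
  assert (Hsigma : 1/2 <= sigma) by (unfold sigma; lra).
  split.
  - intros a b M Hab HM h v. apply ip1_energy_ineq; [|exact Hsigma | exact Hc].
    apply Rdiv_le_0_compat; [lra | apply lt_0_INR; lia].
  - intros L M HL HM h w _. now apply ip2_energy_ineq.
Qed.
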